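(* Let $q$ be a prime power and let $B\subset\mathbb{P}^2$ be the Ballico-Hefez curve over $\mathbb{F}_q$, i.e. the image of the morphism $\Phi:\mathbb{P}^1\to\mathbb{P}^2$, $\Phi(s,t)=(s^{q+1},\,s^{q}t+st^{q},\,t^{q+1})$. Then the zeta function of $B$ (over $\mathbb{F}_q$) is $$Z_B(T)=\frac{(1+T)^{\frac{q^2-q}{2}}}{(1-T)(1-qT)}.$$
   Context: $\mathbb{P}^1,\mathbb{P}^2$ are projective spaces over an algebraic closure $\overline{\mathbb{F}}_q$ of $\mathbb{F}_q$, and $B$ is the plane curve $\Phi(\mathbb{P}^1)$ (with reduced structure), which is defined over $\mathbb{F}_q$. The zeta function of $B$ is $Z_B(T)=\exp\left(\sum_{r\ge 1}N_{q^r}(B)\frac{T^r}{r}\right)$, where $N_{q^r}(B)$ is the number of points of $B$ in $\mathbb{P}^2(\mathbb{F}_{q^r})$. *)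

(* Defs.v *)
From HB Require Import structures.
From mathcomp Require Import all_boot all_order all_algebra all_field.
From mathcomp Require Import finmap all_classical.

Set Implicit Arguments.
Unset Strict Implicit.
Unset Printing Implicit Defensive.

Import GRing.Theory.
Local Open Scope ring_scope.

(* Fps f stands for \sum_n (f n) T^n. *)

Record fps (R : fieldType) : Type := Fps { fcoef : nat -> R }.

Section FormalPowerSeries.
Variable R : fieldType.
Implicit Types a b c : fps R.

HB.instance Definition _ := gen_eqMixin (fps R).
HB.instance Definition _ := gen_choiceMixin (fps R).

Lemma fpsP a b : (forall n, fcoef a n = fcoef b n) -> a = b.
Proof. by case: a b => [f] [g] /= fg; congr Fps; apply/funext. Qed.

Definition fps_zero := @Fps R (fun=> 0).
Definition fps_opp a := Fps (fun n => - fcoef a n).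
Definition fps_add a b := Fps (fun n => fcoef a n + fcoef b n).
Definition fps_one := @Fps R (fun n => (n == 0%N)%:R).
Definition fps_mul a b :=
  Fps (fun n => \sum_(i < n.+1) fcoef a i * fcoef b (n - i)).

Fact fps_addA : associative fps_add.
Proof. by move=> a b c; apply/fpsP=> n /=; rewrite addrA. Qed.
Fact fps_addC : commutative fps_add.
Proof. by move=> a b; apply/fpsP=> n /=; rewrite addrC. Qed.
Fact fps_add0 : left_id fps_zero fps_add.
Proof. by move=> a; apply/fpsP=> n /=; rewrite add0r. Qed.
Fact fps_addN : left_inverse fps_zero fps_opp fps_add.
Proof. by move=> a; apply/fpsP=> n /=; rewrite addNr. Qed.

HB.instance Definition _ :=
  GRing.isZmodule.Build (fps R) fps_addA fps_addC fps_add0 fps_addN.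

Definition fps_trunc n a : {poly R} := \poly_(i < n.+1) fcoef a i.

Fact fps_truncE n m a : (m <= n)%N -> (fps_trunc n a)`_m = fcoef a m.
Proof. by move=> mn; rewrite coef_poly ltnS mn. Qed.

Fact fps_mul_trunc n m a b : (m <= n)%N ->
  fcoef (fps_mul a b) m = (fps_trunc n a * fps_trunc n b)`_m.
Proof.
move=> mn; rewrite coefM /=; apply: eq_bigr => i _.
rewrite !fps_truncE //; first exact: leq_trans (leq_subr _ _) mn.
by apply: leq_trans mn; rewrite -ltnS.
Qed.

Fact fps_mulC : commutative fps_mul.
Proof. by move=> a b; apply/fpsP=> n; rewrite !(fps_mul_trunc _ _ (leqnn n)) mulrC. Qed.

Fact fps_mulA : associative fps_mul.
Proof.
move=> a b c; apply/fpsP=> n.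
transitivity ((fps_trunc n a * (fps_trunc n b * fps_trunc n c))`_n).
  rewrite coefM /=; apply: eq_bigr => i _.
  rewrite fps_truncE; last by rewrite -ltnS.
  by rewrite -(fps_mul_trunc _ _ (leq_subr i n)).
rewrite mulrA coefM /=; apply: eq_bigr => i _.
rewrite fps_truncE ?leq_subr // -fps_mul_trunc //.
by rewrite -ltnS.
Qed.

Fact fps_mul1 : left_id fps_one fps_mul.
Proof.
move=> a; apply/fpsP=> n /=; rewrite big_ord_recl /= subn0 mul1r.
by rewrite big1 ?addr0 // => i _; rewrite mul0r.
Qed.

Fact fps_mulDl : left_distributive fps_mul fps_add.
Proof.
move=> a b c; apply/fpsP=> n /=; rewrite -big_split /=.
by apply: eq_bigr => i _; rewrite mulrDl.
Qed.

Fact fps_one_neq0 : fps_one != 0.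
Proof.
apply/eqP=> /(congr1 (fun a => fcoef a 0)) /= /eqP.
by rewrite oner_eq0.
Qed.

HB.instance Definition _ := GRing.Zmodule_isComNzRing.Build (fps R)
  fps_mulA fps_mulC fps_mul1 fps_mulDl fps_one_neq0.

Fact fcoefD a b n : fcoef (a + b) n = fcoef a n + fcoef b n.
Proof. by []. Qed.

Fact fcoefN a n : fcoef (- a) n = - fcoef a n.
Proof. by []. Qed.

Fact fcoef0 n : fcoef (0 : fps R) n = 0.
Proof. by []. Qed.

Fact fcoef1 n : fcoef (1 : fps R) n = (n == 0%N)%:R.
Proof. by []. Qed.

Fact fcoefM a b n :
  fcoef (a * b) n = \sum_(i < n.+1) fcoef a i * fcoef b (n - i).
Proof. by []. Qed.

Fact fcoef_sum (I : Type) (r : seq I) (P : pred I) (F : I -> fps R) n :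
  fcoef (\sum_(i <- r | P i) F i) n = \sum_(i <- r | P i) fcoef (F i) n.
Proof. by apply: (big_morph (fun a => fcoef a n)). Qed.

Fact fcoefX_small a k n : fcoef a 0 = 0 -> (n < k)%N -> fcoef (a ^+ k) n = 0.
Proof.
move=> a0; elim: k n => // k IHk n; rewrite ltnS => nk.
rewrite exprS fcoefM big_ord_recl a0 mul0r add0r big1 // => i _.
rewrite IHk ?mulr0 // lift0; case: n i nk => [[]//|n] i nk.
by rewrite subSS; apply: leq_ltn_trans (leq_subr _ _) nk.
Qed.

Definition fpsC (x : R) := @Fps R (fun n => if n == 0%N then x else 0).
Definition fpsX := @Fps R (fun n => (n == 1%N)%:R).

(* \sum_k (c k) a^k when a has zero constant term: a^k then has order at     *)
(* least k, so that only the terms k <= n contribute to the n-th coefficient. *)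
Definition fps_comp (c : nat -> R) a :=
  Fps (fun n => \sum_(k < n.+1) c k * fcoef (a ^+ k) n).

(* Meaningful for series with zero constant term, in characteristic 0. *)
Definition fps_exp a := fps_comp (fun k => (k`!%:R)^-1) a.

(* a^-1 = a_0^-1 / (1 - x), with x := 1 - a / a_0 of zero constant term *)
Definition fps_unit : pred (fps R) := fun a => fcoef a 0 != 0.
Definition fps_inv a :=
  if fps_unit a
  then fpsC (fcoef a 0)^-1
         * fps_comp (fun=> 1) (1 - fpsC (fcoef a 0)^-1 * a)
  else a.

Fact fpsCM x a n : fcoef (fpsC x * a) n = x * fcoef a n.
Proof.
rewrite fcoefM big_ord_recl /= subn0 big1 ?addr0 // => i _.
by rewrite mul0r.
Qed.

Fact fps_geom a : fcoef a 0 = 0 -> (1 - a) * fps_comp (fun=> 1) a = 1.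
Proof.
move=> a0; apply/fpsP=> n.
pose g := \sum_(k < n.+1) a ^+ k.
have gE m : (m <= n)%N -> fcoef (fps_comp (fun=> 1) a) m = fcoef g m.
  move=> mn; rewrite /g fcoef_sum /=.
  under eq_bigr do rewrite mul1r.
  rewrite -!(big_mkord xpredT (fun k => fcoef (a ^+ k) m)).
  rewrite [RHS](big_cat_nat (n := m.+1)) //= [X in _ + X]big1_seq ?addr0 //.
  move=> k; rewrite mem_index_iota => /andP[_ /andP[mk _]].
  exact: fcoefX_small.
transitivity (fcoef ((1 - a) * g) n).
  rewrite !fcoefM; apply: eq_bigr => i _; congr (_ * _).
  by rewrite gE ?leq_subr.
by rewrite -opprB mulNr -subrX1 opprB fcoefD fcoefN fcoefX_small // oppr0 addr0.
Qed.

Fact fps_mulV : {in fps_unit, left_inverse 1 fps_inv *%R}.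
Proof.
move=> a ua; rewrite /fps_inv -[fps_unit a]/(a \in fps_unit) ua.
have a0 : fcoef a 0 != 0 by [].
set x := 1 - _; have x0 : fcoef x 0 = 0.
  by rewrite fcoefD fcoefN fpsCM fcoef1 mulVf // subrr.
rewrite mulrAC -[fpsC _ * a](subKr 1) -/x.
exact: fps_geom.
Qed.

Fact fps_unitPl a b : b * a = 1 -> fps_unit a.
Proof.
move=> /(congr1 (fun c => fcoef c 0)).
rewrite fcoefM big_ord_recl big_ord0 addr0 fcoef1 eqxx => ba1.
apply/eqP=> a0; move: ba1; rewrite /= subn0 a0 mulr0 => /esym/eqP.
by rewrite oner_eq0.
Qed.

Fact fps_invr_out : {in [predC fps_unit], fps_inv =1 id}.
Proof. by move=> a; rewrite inE /= /fps_inv -topredE /= => /negbTE->. Qed.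

HB.instance Definition _ := GRing.ComNzRing_hasMulInverse.Build (fps R)
  fps_mulV fps_unitPl fps_invr_out.

End FormalPowerSeries.

Notation "''T'" := (fpsX _) (at level 0) : ring_scope.

(* Points of P^n(K) are the lines through the origin of K^(n+1). *)

Section Projective.
Variables (K : fieldType) (n : nat).

Definition proj := {U : {vspace 'rV[K]_n.+1} | \dim U == 1%N}.

Fact dim_line (v : 'rV[K]_n.+1) : v != 0 -> \dim <[v]>%VS == 1%N.
Proof. by move=> v0; rewrite dim_vline v0. Qed.

Definition proj_pt (v : 'rV[K]_n.+1) (v0 : v != 0) : proj :=
  exist _ <[v]>%VS (dim_line v0).

Definition proj_rep (P : proj) : 'rV[K]_n.+1 := vpick (val P).

Fact proj_rep_neq0 P : proj_rep P != 0.
Proof. by rewrite vpick0 -dimv_eq0 (eqP (valP P)). Qed.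

Fact proj_repK P : proj_pt (proj_rep_neq0 P) = P.
Proof.
apply/val_inj/eqP; rewrite /= eqEdim (eqP (valP P)).
by rewrite dim_vline proj_rep_neq0 andbT -memvE memv_pick.
Qed.

End Projective.

(* The subfield of order m of an algebraically closed field K of             *)
(* characteristic p, for m a power of p (see card_Fsub below).               *)
Definition Fsub (K : fieldType) (m : nat) : set K := [set x | x ^+ m = x]%classic.
Arguments Fsub K m : clear implicits.

Lemma Fsub_divring (K : fieldType) (p m : nat) : p \in [pchar K] ->
  divring_closed (fun x : K => x \in Fsub K (p ^ m)).
Proof.
move=> charKp; have pn : [pchar K].-nat (p ^ m)%N.
  by rewrite (eq_pnat _ (pcharf_eq charKp)) pnatX pnat_id ?(pcharf_prime charKp).
split; rewrite ?unfold_in.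
- by rewrite in_setE /Fsub /= expr1n.
- move=> x y; rewrite !unfold_in !in_setE /Fsub /= => xE yE.
  by rewrite exprDn_pchar // exprNn_pchar // xE yE.
- move=> x y; rewrite !unfold_in !in_setE /Fsub /= => xE yE.
  by rewrite expr_div_n xE yE.
Qed.

Lemma card_Fsub (K : closedFieldType) (p m : nat) :
  p \in [pchar K] -> (0 < m)%N ->
  exists2 s : (p ^ m).-tuple K, uniq s & Fsub K (p ^ m) = [set` s]%classic.
Proof.
move=> charKp m0; have p_pr := pcharf_prime charKp.
set n := (p ^ m)%N; have n1 : (1 < n)%N.
  by rewrite -(exp1n m) ltn_exp2r // prime_gt1.
pose f : {poly K} := 'X^n - 'X.
have sf : size f = n.+1 by rewrite size_polyDl size_polyXn // size_polyN size_polyX.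
have fE x : root f x = (x ^+ n == x) by rewrite rootE !hornerE subr_eq0.
have [rs fP] := closed_field_poly_normal f.
have lf : lead_coef f = 1.
  by rewrite lead_coefDl ?lead_coefXn // size_polyXn size_polyN size_polyX.
rewrite lf scale1r in fP.
have szrs : size rs == n by rewrite -eqSS -(size_prod_XsubC _ id) -fP sf.
exists (Tuple szrs).
  rewrite /= -separable_prod_XsubC -fP unlock derivB derivXn derivX.
  rewrite -mulr_natl /n -(subnK m0) addn1 expnS natrM.
  have -> : (p%:R : {poly K}) = 0 by rewrite -polyC_natr pcharf0.
  by rewrite !mul0r sub0r -scaleN1r coprimepZr ?coprimep1 // oppr_eq0 oner_eq0.
apply/seteqP; split => x /=; rewrite /Fsub /= -root_prod_XsubC -fP fE.
  by move/eqP.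
by move/eqP.
Qed.

(* For m as above, this is P^n(F_m), as a subset of P^n(K). *)
Definition proj_rational (K : fieldType) (n m : nat) : set (proj K n) :=
  [set P | exists (v : 'rV[K]_n.+1) (v0 : v != 0),
      P = proj_pt v0 /\ forall i, Fsub K m (v 0 i)]%classic.
Arguments proj_rational K n m : clear implicits.

Lemma finite_rational (K : closedFieldType) (n p m : nat) :
  p \in [pchar K] -> (0 < m)%N -> finite_set (proj_rational K n (p ^ m)).
Proof.
move=> charKp m0; have [s _ sE] := card_Fsub charKp m0.
have [->|/set0P[P0 _]] := eqVneq (proj_rational K n (p ^ m)) set0.
  exact: finite_set0.
pose g (f : {ffun 'I_n.+1 -> seq_sub s}) :=
  insubd P0 <[\row_i ssval (f i)]>%VS.
apply: (@sub_finite_set _ _ (range g)); last exact/finite_image/finite_finset.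
move=> _ [v [v0 [-> vs]]]; have vs' i : v 0 i \in tval s.
  by have := vs i; rewrite sE.
exists [ffun i => SeqSub (vs' i)] => //.
have -> : g [ffun i => SeqSub (vs' i)] = insubd P0 (val (proj_pt v0)).
  by congr (insubd _ <[_]>%VS); apply/rowP => i; rewrite mxE ffunE.
exact: valKd.
Qed.

(* fset_set A is empty when A is infinite; by finite_rational, this is not the *)
(* case for m a power of the characteristic.                                  *)
Definition card_rational (K : fieldType) (n m : nat) (X : set (proj K n)) : nat :=
  #|` fset_set (X `&` proj_rational K n m)%classic|.

Definition zeta (K : fieldType) (n q : nat) (X : set (proj K n)) : fps rat :=
  fps_exp (Fps (fun r =>
    if r == 0%N then 0 else (card_rational (q ^ r) X)%:R / r%:R)).

Section BallicoHefez.
Variables (K : fieldType) (q : nat).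

Definition Phi_vec (v : 'rV[K]_2) : 'rV[K]_3 :=
  let s := v 0 0 in let t := v 0 1 in
  \row_(i < 3) [:: s ^+ q.+1; s ^+ q * t + s * t ^+ q; t ^+ q.+1]`_i.

Fact Phi_vec_neq0 v : v != 0 -> Phi_vec v != 0.
Proof.
apply: contraNneq => /rowP Phi0; apply/eqP/rowP => i; rewrite mxE.
have /eqP := Phi0 0; have /eqP := Phi0 (Ordinal (isT : (2 < 3)%N)).
rewrite !mxE /= !expf_eq0 /= => /eqP t0 /eqP s0.
by case: i => [[|[|[]]] //= i2]; [rewrite -[RHS]s0|rewrite -[RHS]t0];
  congr (v 0 _); apply: val_inj.
Qed.

Definition Phi (P : proj K 1) : proj K 2 :=
  proj_pt (Phi_vec_neq0 (proj_rep_neq0 P)).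

(* Phi does not depend on the chosen homogeneous coordinates. *)
Lemma PhiE v (v0 : v != 0) : Phi (proj_pt v0) = proj_pt (Phi_vec_neq0 v0).
Proof.
have /vlineP[c wE] : proj_rep (proj_pt v0) \in <[v]>%VS by exact: memv_pick.
apply/val_inj/eqP; rewrite /= eqEdim !dim_vline.
rewrite (Phi_vec_neq0 v0) (Phi_vec_neq0 (proj_rep_neq0 _)) andbT -memvE.
apply/vlineP; exists (c ^+ q.+1); apply/rowP => i; rewrite wE !mxE.
case: i => [[|[|[]]] //= _]; rewrite !exprMn //.
by rewrite mulrDr exprSr mulrACA [c * _ * _]mulrACA [c * _]mulrC.
Qed.

Definition BallicoHefez : set (proj K 2) := range Phi.

End BallicoHefez.

Arguments BallicoHefez K q : clear implicits.

(* Main.v *)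
Require Import Defs.
From mathcomp Require Import all_boot all_order all_algebra all_field.
From mathcomp Require Import finmap all_classical.
From mathcomp Require Import ring zify.

(** Away from the point Phi(1, 0) at infinity, the curve B is the image of the
affine line under s |-> (s^(q+1), s^q + s).  The two coordinates are the
product and the sum of s and s^q, so a fibre consists of solutions t of
(t - s) (t - s^q) = 0, and t = s^q is a solution of the full system exactly
when s^(q^2) = s.  Hence Phi is injective on the line except that it
identifies s with s^q for s in F_(q^2) but not in F_q; this creates
m = (q^2 - q) / 2 nodes ([eq_Phi_affine]).

Put Q = q^r.  The image of s is rational over F_Q exactly when the Q-th power
of s lies in the same fibre as s, that is, when s is in F_Q or in F_(q^2)
([Phi_affine_rational_iff]): an F_Q-rational node may have its two branches
defined over F_Q, or exchanged by Frobenius.  If r is even, F_(q^2) lies in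
F_Q and the Q + 1 points of the projective line lose m points by the
identifications.  If r is odd, F_(q^2) meets F_Q in F_q, no identification
occurs among points of F_Q, and the m nodes are additional rational points.
In both cases N_Q = Q + 1 - (-1)^r m ([card_rational_BallicoHefez]).

To pass from these numbers to the zeta function, logarithmic derivatives are
compared.  Over a field of characteristic 0 a power series is determined by
its constant term and its logarithmic derivative ([has_logderiv_inj]); that of
exp(L) is L' ([has_logderiv_exp]), that of 1 - xT is the geometric series
- sum_n x^(n+1) T^n, and logarithmic derivatives add under products.  So the
term x^r in N_Q contributes a factor 1 / (1 - xT), with x = q, 1 and -1, the
last one with exponent -m ([fps_exp_count]). *)

Set Implicit Arguments.
Unset Strict Implicit.
Unset Printing Implicit Defensive.

Import GRing.Theory Num.Theory.
Local Open Scope ring_scope.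

(** * Logarithmic derivatives of formal power series *)

Section Derivation.
Variable R : fieldType.
Implicit Types a b u : fps R.

Definition fps_deriv a := Fps (fun n => fcoef a n.+1 *+ n.+1).

Lemma fcoef_deriv a n : fcoef (fps_deriv a) n = fcoef a n.+1 *+ n.+1.
Proof. by []. Qed.

Lemma fps_trunc_deriv n a : fps_trunc n (fps_deriv a) = (fps_trunc n.+1 a)^`().
Proof.
apply/polyP => i; rewrite coef_deriv !coef_poly !ltnS.
by case: ifP => // _; rewrite mul0rn.
Qed.

(** Both sides at degree n only see finitely many coefficients, so the Leibniz
rule follows from the one for polynomials applied to truncations. *)
Lemma fps_derivM a b :
  fps_deriv (a * b) = fps_deriv a * b + a * fps_deriv b.
Proof.
apply/fpsP => n; rewrite fcoef_deriv fcoefD.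
rewrite [fcoef (a * b) _](fps_mul_trunc a b (leqnn n.+1)).
rewrite -coef_deriv derivM coefD -!fps_trunc_deriv.
by congr (_ + _); rewrite coefM fcoefM; apply: eq_bigr => i _;
  rewrite !fps_truncE ?leq_subr ?leqW ?leq_subr // -ltnS.
Qed.

Lemma fps_derivD a b : fps_deriv (a + b) = fps_deriv a + fps_deriv b.
Proof. by apply/fpsP => n; rewrite !(fcoef_deriv, fcoefD) mulrnDl. Qed.

Lemma fps_deriv1 : fps_deriv 1 = 0.
Proof. by apply/fpsP => n; rewrite fcoef_deriv fcoef1 mul0rn. Qed.

Lemma fps_derivXn a k : fps_deriv (a ^+ k.+1) = fps_deriv a * a ^+ k *+ k.+1.
Proof.
elim: k => [|k IHk]; first by rewrite mulr1.
by rewrite exprS fps_derivM IHk mulrnAr mulrCA -exprS -mulrS.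
Qed.

Lemma fps_derivZ x a : fps_deriv (fpsC x * a) = fpsC x * fps_deriv a.
Proof. by apply/fpsP => n; rewrite fcoef_deriv !fpsCM fcoef_deriv mulrnAr. Qed.

(** Stated without a quotient so that it makes sense for every a; for a unit a
it determines u as a' / a. *)
Definition has_logderiv a u := fps_deriv a = u * a.

Lemma has_logderivM a b u w :
  has_logderiv a u -> has_logderiv b w -> has_logderiv (a * b) (u + w).
Proof.
by rewrite /has_logderiv fps_derivM mulrDl => -> ->; rewrite -mulrA [a * (w * _)]mulrCA.
Qed.

Lemma has_logderivX a u m : has_logderiv a u -> has_logderiv (a ^+ m) (u *+ m).
Proof.
move=> au; elim: m => [|m IHm]; first by rewrite /has_logderiv fps_deriv1 mul0r.
by rewrite exprS mulrS; apply: has_logderivM.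
Qed.

Lemma has_logderivV a u :
  a \is a GRing.unit -> has_logderiv a u -> has_logderiv a^-1 (- u).
Proof.
move=> ua au; apply: (mulrI ua).
have := fps_derivM a a^-1; rewrite divrr // fps_deriv1 au => /esym/eqP.
rewrite addrC addr_eq0 => /eqP ->.
by rewrite -mulrA [u * _]mulrCA mulNr mulrN.
Qed.

(** In characteristic 0 the equation a' = u a is a recursion giving the
coefficient of degree n + 1 in terms of those of degree at most n. *)
Lemma has_logderiv_inj a b u : [pchar R] =i pred0 ->
  fcoef a 0 = fcoef b 0 -> has_logderiv a u -> has_logderiv b u -> a = b.
Proof.
move=> char0 ab0 au bu; apply/fpsP => n.
suff H m : (m <= n)%N -> fcoef a m = fcoef b m by exact: H.
elim: n m => [|n IHn] m; first by rewrite leqn0 => /eqP->.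
rewrite leq_eqVlt => /orP[/eqP->|]; last exact: IHn.
have n0 : (n.+1)%:R != 0 :> R by rewrite ((GRing.pcharf0P R).1 char0).
apply: (mulIf n0); rewrite !mulr_natr -!fcoef_deriv au bu !fcoefM.
by apply: eq_bigr => i _; rewrite IHn ?leq_subr.
Qed.

(** The partial sums E_m of the exponential series satisfy
E_(m+1)' = a' E_m, and E_m agrees with exp(a) in all degrees below m. *)
Lemma has_logderiv_exp a : [pchar R] =i pred0 -> fcoef a 0 = 0 ->
  has_logderiv (fps_exp a) (fps_deriv a).
Proof.
move=> char0 a0.
pose E m := \sum_(k < m) fpsC (k`!%:R)^-1 * a ^+ k.
have expE n m : (n < m)%N -> fcoef (fps_exp a) n = fcoef (E m) n.
  move=> nm; rewrite /E fcoef_sum.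
  under [RHS]eq_bigr do rewrite fpsCM.
  rewrite [LHS]/=.
  rewrite -!(big_mkord xpredT (fun k => (k`!%:R)^-1 * fcoef (a ^+ k) n)).
  rewrite [RHS](big_cat_nat (n := n.+1)) //= [X in _ + X]big1_seq ?addr0 //.
  move=> k; rewrite mem_index_iota => /andP[_ /andP[nk _]].
  by rewrite fcoefX_small ?mulr0.
have derivE m : fps_deriv (E m.+1) = fps_deriv a * E m.
  elim: m => [|m IHm].
    rewrite /E big_ord1 big_ord0 mulr0.
    by apply/fpsP => n; rewrite fcoef_deriv fpsCM fcoef1 mulr0 mul0rn.
  rewrite {1}/E big_ord_recr /= -/(E m.+1) fps_derivD IHm [in RHS]/E.
  rewrite big_ord_recr /= -/(E m) mulrDr; congr (_ + _).
  rewrite fps_derivZ fps_derivXn -mulrnAr mulrCA; congr (_ * _).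
  apply/fpsP => n; rewrite !fpsCM.
  have -> : fcoef (a ^+ m *+ m.+1) n = fcoef (a ^+ m) n *+ m.+1.
    by elim: (m.+1) => [|j IHj]; rewrite ?mulr0n // !mulrS fcoefD IHj.
  rewrite -(mulr_natl (fcoef _ _)) mulrA factS natrM invfM [_ * m.+1%:R]mulrAC mulVf ?mul1r //.
  by rewrite ((GRing.pcharf0P R).1 char0).
apply/fpsP => n; rewrite fcoef_deriv (expE _ n.+2) // -fcoef_deriv derivE !fcoefM.
apply: eq_bigr => i _; congr (_ * _).
by rewrite (expE _ n.+1) // ltnS leq_subr.
Qed.

End Derivation.

Section Geometric.
Variable R : fieldType.

Lemma fps_unitE (a : fps R) : (a \is a GRing.unit) = (fcoef a 0 != 0).
Proof. by []. Qed.

Lemma fpsC_natr n : fpsC n%:R = n%:R :> fps R.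
Proof.
elim: n => [|n IHn]; apply/fpsP => i; first by rewrite /= if_same.
by rewrite -[in RHS]natr1 -IHn fcoefD fcoef1 /=; case: eqP => _; rewrite ?natr1 ?addr0.
Qed.

Lemma fcoef_inv_lin (x : R) n : fcoef (1 - fpsC x * 'T)^-1 n = x ^+ n.
Proof.
set a := 1 - _; have ua : a \is a GRing.unit.
  by rewrite fps_unitE fcoefD fcoefN fpsCM mulr0 subr0 oner_neq0.
suff -> : a^-1 = Fps (fun n => x ^+ n) by [].
apply: (mulrI ua); rewrite divrr // mulrBl mul1r -mulrA.
apply/fpsP => -[|m]; rewrite fcoefD fcoefN fpsCM fcoefM fcoef1.
  by rewrite big_ord1 mul0r mulr0 subr0.
rewrite big_ord_recl mul0r add0r big_ord_recl mul1r big1 ?addr0.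
  by rewrite /= subSS subn0 -exprS subrr.
by move=> i _; rewrite mul0r.
Qed.

Lemma has_logderiv_lin (x : R) :
  has_logderiv (1 - fpsC x * 'T) (- fpsC x * (1 - fpsC x * 'T)^-1).
Proof.
have ua : 1 - fpsC x * 'T \is a GRing.unit.
  by rewrite fps_unitE fcoefD fcoefN fpsCM mulr0 subr0 oner_neq0.
rewrite /has_logderiv mulrVK //; apply/fpsP => -[|n].
  by rewrite fcoef_deriv fcoefD !fcoefN fpsCM fcoef1 /= mulr1 add0r.
by rewrite fcoef_deriv fcoefD !fcoefN fpsCM fcoef1 /= mulr0 oppr0 addr0 mul0rn.
Qed.

End Geometric.

(** Each geometric term x^r in N_r turns into a factor (1 - xT)^-1, since both
have the logarithmic derivative whose coefficient of degree n is x^(n+1). *)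
Lemma fps_exp_count (N : nat -> nat) (q m : nat) :
  (forall r, (0 < r)%N -> (N r)%:R = q%:R ^+ r + 1 - (-1) ^+ r * m%:R :> rat) ->
  fps_exp (Fps (fun r => if r == 0%N then 0 else (N r)%:R / r%:R)) =
    (1 + 'T) ^+ m / ((1 - 'T) * (1 - q%:R * 'T)) :> fps rat.
Proof.
move=> NE; set L := Fps _.
have char0 := Num.Theory.pchar_num rat.
(* The three factors are the values of this family at x = -1, 1 and q. *)
pose lin x : fps rat := 1 - fpsC x * 'T.
have fpsC1 : fpsC 1 = 1 :> fps rat by rewrite (fpsC_natr rat 1).
have <- : lin (-1) = 1 + 'T.
  by apply/fpsP => n; rewrite !(fcoefD, fcoefN) fpsCM mulN1r opprK.
have <- : lin 1 = 1 - 'T by rewrite /lin fpsC1 mul1r.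
have <- : lin q%:R = 1 - q%:R * 'T by rewrite /lin fpsC_natr.
have lin0 x : fcoef (lin x) 0 = 1 by rewrite fcoefD fcoefN fpsCM mulr0 subr0.
have Ulin x : lin x \is a GRing.unit by rewrite fps_unitE lin0 oner_neq0.
pose ld x := - fpsC x * (lin x)^-1.
have ldP x : has_logderiv (lin x) (ld x) by exact: has_logderiv_lin.
have ldE x n : fcoef (ld x) n = - x ^+ n.+1.
  by rewrite /ld mulNr fcoefN fpsCM fcoef_inv_lin exprS.
have U : lin 1 * lin q%:R \is a GRing.unit by rewrite unitrM !Ulin.
apply: (@has_logderiv_inj _ _ _ (ld (-1) *+ m - (ld 1 + ld q%:R))) => //.
- have coef0M (a b : fps rat) : fcoef (a * b) 0 = fcoef a 0 * fcoef b 0.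
    by rewrite fcoefM big_ord1.
  have -> : fcoef (fps_exp L) 0 = 1 by rewrite /= big_ord1 fcoef1 mulr1 fact0 invr1.
  rewrite coef0M; have -> : fcoef (lin (-1) ^+ m) 0 = 1.
    by elim: m {NE} => // m IHm; rewrite exprS coef0M IHm lin0 mulr1.
  have /(congr1 (fun a => fcoef a 0)) := divrr U.
  by rewrite !coef0M !lin0 !mul1r => ->.
- suff <- : fps_deriv L = ld (-1) *+ m - (ld 1 + ld q%:R).
    exact: has_logderiv_exp.
  apply/fpsP => n; rewrite fcoefD fcoefN fcoefD.
  have -> : fcoef (ld (-1) *+ m) n = fcoef (ld (-1)) n *+ m.
    by elim: m {NE} => [|j IHj]; rewrite ?mulr0n // !mulrS fcoefD IHj.
  rewrite fcoef_deriv !ldE /= -(mulr_natr (_ / _)) mulfVK ?pnatr_eq0 // NE // expr1n.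
  by ring.
- apply: has_logderivM; first exact/has_logderivX/ldP.
  by apply: has_logderivV => //; apply: has_logderivM.
Qed.

(** * Cardinals of images *)

Lemma card_imfset_fibre (I J : choiceType) (f : I -> J) (D : {fset I}) k :
  (forall x, x \in D -> #|` [fset y in D | f y == f x]%fset| = k) ->
  #|` D| = (#|` f @` D|%fset * k)%N.
Proof.
move=> Dk; rewrite card_fset_sum1 (partition_big_imfset _ f) /= -sum1_size big_distrl /=.
apply: eq_big_seq => _ /imfsetP[x /= xD ->]; rewrite mul1n -(Dk x xD).
rewrite card_fset_sum1 big_fset_condE /=; by [].
Qed.

Lemma imfset_cardU_disjoint (I J : choiceType) (f : I -> J) (D E : {fset I}) :
  {in D & E, forall x y, f x != f y} ->
  #|` f @` (D `|` E)|%fset = (#|` f @` D|%fset + #|` f @` E|%fset)%N.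
Proof.
move=> DE; rewrite imfsetU cardfsU (_ : _ `&` _ = fset0)%fset ?cardfs0 ?subn0 //.
apply/fsetP => z; rewrite !inE; apply/andP => -[/imfsetP[x /= xD ->]].
by move=> /imfsetP[y /= yE] /eqP; apply/negP; apply: DE.
Qed.

(** * Points of the projective line *)

Section ProjectiveLine.
Variable K : fieldType.
Implicit Types s t : K.

Lemma eq_proj_pt n (v w : 'rV[K]_n.+1) (v0 : v != 0) (w0 : w != 0) :
  proj_pt v0 = proj_pt w0 <-> exists c, v = c *: w.
Proof.
split=> [/(congr1 val) /= vw|[c vw]].
  by apply/vlineP; rewrite -vw memv_line.
apply/val_inj/eqP; rewrite /= eqEdim !dim_vline v0 w0 andbT -memvE.
by apply/vlineP; exists c.
Qed.

Definition pair_vec (s t : K) : 'rV[K]_2 := \row_i [:: s; t]`_i.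

Lemma affine_vec_neq0 s : pair_vec s 1 != 0.
Proof. by apply/eqP => /rowP/(_ 1)/eqP; rewrite !mxE oner_eq0. Qed.

Lemma infinity_vec_neq0 : pair_vec 1 0 != 0.
Proof. by apply/eqP => /rowP/(_ 0)/eqP; rewrite !mxE oner_eq0. Qed.

Definition affine_pt s : Defs.proj K 1 := proj_pt (affine_vec_neq0 s).
Definition infinity_pt : Defs.proj K 1 := proj_pt infinity_vec_neq0.

Lemma proj_line_cases P : P = infinity_pt \/ exists s, P = affine_pt s.
Proof.
rewrite -(proj_repK P); move: (proj_rep P) (proj_rep_neq0 P) => v v0.
have [t0|t0] := eqVneq (v 0 1) 0; [left|right; exists (v 0 0 / v 0 1)].
  apply/eq_proj_pt; exists (v 0 0); apply/rowP => -[[|[|[]]] //= i2]; rewrite !mxE /=.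
    by rewrite mulr1; congr (v 0 _); apply: val_inj.
  by rewrite mulr0 -[RHS]t0; congr (v 0 _); apply: val_inj.
apply/eq_proj_pt; exists (v 0 1); apply/rowP => -[[|[|[]]] //= i2]; rewrite !mxE /=.
  by rewrite mulrCA divff // mulr1; congr (v 0 _); apply: val_inj.
by rewrite mulr1; congr (v 0 _); apply: val_inj.
Qed.

End ProjectiveLine.

(** * Fibres and rational points of the parametrization *)

Section Fibres.
Variables (K : fieldType) (q : nat).
Implicit Types s t : K.
Local Notation Phi := (@Phi K q).

Lemma Phi_affineE s :
  Phi_vec q (pair_vec s 1) = \row_(i < 3) [:: s ^+ q.+1; s ^+ q + s; 1]`_i.
Proof.
by apply/rowP => i; rewrite !mxE /= !expr1n !mulr1.
Qed.

Lemma Phi_affine_eq s t : Phi (affine_pt s) = Phi (affine_pt t) <->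
  s ^+ q.+1 = t ^+ q.+1 /\ s ^+ q + s = t ^+ q + t.
Proof.
rewrite !PhiE; split=> [/eq_proj_pt[c]|[sN sT]]; last first.
  by apply/eq_proj_pt; exists 1; rewrite scale1r !Phi_affineE sN sT.
rewrite !Phi_affineE => /rowP st.
have := st 2; have := st 1; have := st 0; rewrite !mxE /= mulr1.
by move=> -> -> <-; rewrite !mul1r.
Qed.

Lemma Phi_affine_neq_infinity s : Phi (affine_pt s) <> Phi (infinity_pt K).
Proof.
rewrite !PhiE => /eq_proj_pt[c]; rewrite Phi_affineE => /rowP/(_ 2).
by rewrite !mxE /= expr0n mulr0 => /eqP; rewrite oner_eq0.
Qed.

(** The pairs (s, s^q) and (t, t^q) have the same sum and product, so t is a
root of (X - s) (X - s^q).  If t = s^q, equality of the sums gives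
s^(q^2) = s. *)
Lemma eq_Phi_affine s t : Phi (affine_pt t) = Phi (affine_pt s) <->
  t = s \/ t = s ^+ q /\ s ^+ (q ^ 2) = s.
Proof.
split=> [/Phi_affine_eq|].
  case=> N T; have /eqP : (t - s) * (t - s ^+ q) = 0.
    have -> : (t - s) * (t - s ^+ q) = t * t - t * (s ^+ q + s) + s ^+ q.+1.
      by rewrite exprS; ring.
    by rewrite -N -T exprS; ring.
  rewrite mulf_eq0 !subr_eq0 => /orP[/eqP->|/eqP tE]; [by left|right].
  split=> //; move: T; rewrite tE -exprM mulnn addrC => /addrI //.
case=> [->//|[-> sE]]; apply/Phi_affine_eq; rewrite [X in X = _]exprS -exprM mulnn sE.
by split; rewrite ?[in RHS]exprS 1?mulrC 1?addrC.
Qed.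

Lemma Phi_infinity_rational m : (0 < m)%N -> proj_rational K 2 m (Phi (infinity_pt K)).
Proof.
move=> m0; rewrite PhiE; eexists; eexists; split; first by [].
case=> [[|[|[]]] //= i]; rewrite !mxE /Fsub /= ?expr1n //.
  rewrite mulr0 add0r mul1r expr0n.
  by case: eqP => _; rewrite ?expr1n // expr0n gtn_eqF.
by rewrite !expr0n gtn_eqF.
Qed.

(** The last coordinate of Phi(s, 1) is 1, so a representative with
coordinates in F_m can be normalized without leaving F_m. *)
Lemma Phi_affine_rational m s : proj_rational K 2 m (Phi (affine_pt s)) <->
  (s ^+ q.+1) ^+ m = s ^+ q.+1 /\ (s ^+ q + s) ^+ m = s ^+ q + s.
Proof.
rewrite PhiE; split=> [[v [v0 [/eq_proj_pt[c]]]]|[N T]].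
  rewrite Phi_affineE => /rowP vE vm.
  have := vE 2; have := vE 1; have := vE 0; rewrite !mxE /= => -> -> c1.
  (* c is the inverse of the last coordinate of v *)
  have cm : c ^+ m = c.
    have c0 : c != 0 by apply/eqP=> c0; move/eqP: c1; rewrite c0 mul0r oner_eq0.
    apply: invr_inj; rewrite -exprVn -[c^-1]mulr1 c1 mulKf //; exact: vm.
  by rewrite !exprMn cm !vm.
eexists; eexists; split; first by [].
move=> i; rewrite Phi_affineE mxE /Fsub /=.
by case: i => [[|[|[]]] //= i]; rewrite expr1n.
Qed.

End Fibres.

(** * Counting rational points *)

Section Frobenius.
Variables (K : closedFieldType) (p : nat).
Hypothesis charK : p \in [pchar K].

Lemma Fsub_fset m : (0 < m)%N ->
  exists2 A : {fset K}, #|` A| = (p ^ m)%N & forall x, (x \in A) = (x ^+ (p ^ m) == x).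
Proof.
move=> m0; have [s s_uniq sE] := card_Fsub charK m0.
exists [fset x in tval s]%fset; first by rewrite card_fseq undup_id // size_tuple.
move=> x; rewrite !inE; apply/idP/eqP => [xs|xm].
  by have : Fsub K (p ^ m) x by rewrite sE.
by have : Fsub K (p ^ m) x by []; rewrite sE.
Qed.

Variables (e q : nat).
Hypotheses (e_gt0 : (0 < e)%N) (q_def : q = (p ^ e)%N).
Local Notation Phi := (@Phi K q).
Implicit Types s t : K.

Lemma qX_def r : (q ^ r)%N = (p ^ (e * r))%N.
Proof. by rewrite q_def expnM. Qed.

Lemma frobD r s t : (s + t) ^+ (q ^ r) = s ^+ (q ^ r) + t ^+ (q ^ r).
Proof.
rewrite exprDn_pchar // qX_def (eq_pnat _ (pcharf_eq charK)).
by rewrite pnatX pnat_id ?(pcharf_prime charK).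
Qed.

(** The affine coordinates of Phi are polynomials over the prime field, hence
commute with Frobenius: a point of the image is rational when its fibre is
stable under Frobenius. *)
Lemma Phi_affine_rationalE r s :
  proj_rational K 2 (q ^ r) (Phi (affine_pt s)) <->
  Phi (affine_pt (s ^+ (q ^ r))) = Phi (affine_pt s).
Proof.
suff <- : (s ^+ q.+1) ^+ (q ^ r) = s ^+ q.+1 /\ (s ^+ q + s) ^+ (q ^ r) = s ^+ q + s
    <-> Phi (affine_pt (s ^+ (q ^ r))) = Phi (affine_pt s).
  exact: Phi_affine_rational.
by rewrite frobD -!exprM ![(_ * q ^ r)%N]mulnC !exprM; split=> /Phi_affine_eq.
Qed.

Lemma expr_frob_parity r s : s ^+ (q ^ 2) = s ->
  s ^+ (q ^ r) = if odd r then s ^+ q else s.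
Proof.
move=> sE; elim: r => [|r IHr]; first by rewrite expn0 expr1.
rewrite expnSr exprM IHr /=; case: (odd r) => //=.
by rewrite -exprM mulnn.
Qed.

(** The second alternative adds nothing to the first for even r; for odd r,
Frobenius of F_Q acts on F_(q^2) as s |-> s^q and so exchanges the two
preimages of a node. *)
Lemma Phi_affine_rational_iff r s :
  proj_rational K 2 (q ^ r) (Phi (affine_pt s)) <->
  s ^+ (q ^ r) = s \/ s ^+ (q ^ 2) = s.
Proof.
split=> [/Phi_affine_rationalE/eq_Phi_affine[|[]]|H]; try by [left|right].
apply/Phi_affine_rationalE/eq_Phi_affine.
case: H => [|sE]; [by left|rewrite (expr_frob_parity _ sE)].
by case: odd; [right|left].
Qed.

Lemma BallicoHefez_rationalE r (A B : {fset K}) :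
  (forall s, (s \in A) = (s ^+ (q ^ r) == s)) ->
  (forall s, (s \in B) = (s ^+ (q ^ 2) == s)) ->
  (BallicoHefez K q `&` proj_rational K 2 (q ^ r) =
    [set` (Phi (infinity_pt K)
             |` (fun s => Phi (affine_pt s)) @` (A `|` B))%fset])%classic.
Proof.
move=> AE BE; apply/seteqP; split=> P /=.
  move=> [[Q _ <-]]; have [->|[s ->]] := proj_line_cases Q.
    by move=> _; rewrite !inE eqxx.
  move=> /Phi_affine_rational_iff sE; rewrite !inE; apply/orP; right.
  apply: (in_imfset _ (fun s => Phi (affine_pt s))); rewrite /= !inE AE BE.
  by case: sE => ->; rewrite eqxx ?orbT.
rewrite !inE => /orP[/eqP->|/imfsetP[s /= sE ->]].
  split; first by exists (infinity_pt K).
  by apply: Phi_infinity_rational; rewrite qX_def expn_gt0 prime_gt0 ?(pcharf_prime charK).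
split; first by exists (affine_pt s).
apply/Phi_affine_rational_iff; move: sE; rewrite !inE AE BE.
by case/orP => /eqP; [left|right].
Qed.

(** With A, B and C the subfields of order q^r, q^2 and q, the affine rational
points are the image of the union of A and B, which splits into D = B \ C,
where Phi is two-to-one, and its complement E, where Phi is injective; the
images of D and E are disjoint since D is a union of fibres.  Only the
intersection of A and B, hence the size of E, depends on the parity of r. *)
Lemma card_rational_BallicoHefez (R : pzRingType) r : (0 < r)%N ->
  (card_rational (q ^ r) (BallicoHefez K q))%:R =
    q%:R ^+ r + 1 - (-1) ^+ r * ((q ^ 2 - q) %/ 2)%:R :> R.
Proof.
move=> r0; have p1 : (1 < p)%N by rewrite prime_gt1 ?(pcharf_prime charK).
have q1 : (1 < q)%N by rewrite q_def -(exp1n e) ltn_exp2r.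
have [A cardA AE] := @Fsub_fset (e * r) (ltac:(by rewrite muln_gt0 e_gt0)).
have [B cardB BE] := @Fsub_fset (e * 2) (ltac:(by rewrite muln_gt0 e_gt0)).
have [C cardC CE] := @Fsub_fset (e * 1) (ltac:(by rewrite muln_gt0 e_gt0)).
rewrite -!qX_def expn1 in cardA cardB cardC AE BE CE.
pose f s := Phi (affine_pt s).
have sCB : (C `<=` B)%fset.
  by apply/fsubsetP => x; rewrite CE BE -mulnn exprM => /eqP xq; rewrite !xq.
(* The parameters of the branches at the nodes. *)
pose D := (B `\` C)%fset.
have cardD : #|` D| = (q ^ 2 - q)%N by rewrite cardfsDS // cardB cardC.
have fibre s t : f t = f s <-> t = s \/ t = s ^+ q /\ s \in B.
  by rewrite BE; split=> [/eq_Phi_affine[|[? /eqP]]|[|[? /eqP]]]; try (by [left|right]);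
    move=> *; apply/eq_Phi_affine; [left|right].
have frobB s : s \in B -> s ^+ q \in B.
  by rewrite !BE -!exprM mulnC => /eqP sE; rewrite exprM sE.
have frobD_mem s : s \in D -> s ^+ q \in D.
  rewrite !in_fsetD => /andP[sC sB]; rewrite frobB // andbT.
  apply: contra sC; rewrite !CE -exprM mulnn => /eqP sq.
  by move: sB; rewrite BE sq.
have fibreD s : s \in D -> #|` [fset t in D | f t == f s]%fset| = 2%N.
  move=> sD; have /andP[sC sB] : (s \notin C) && (s \in B) by rewrite -in_fsetD.
  have -> : [fset t in D | f t == f s]%fset = [fset s; s ^+ q]%fset.
    apply/fsetP => t; rewrite in_fset2 !inE [_ && _]/= -in_fsetD; apply/andP/orP.
      by case=> _ /eqP/fibre[->|[-> _]]; rewrite eqxx; [left|right].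
    case=> /eqP->; first by [].
    by split; [apply: frobD_mem|apply/eqP/fibre; right].
  by rewrite cardfs2 eq_sym -CE sC.
have imD : #|` f @` D|%fset = ((q ^ 2 - q) %/ 2)%N.
  by rewrite -cardD (card_imfset_fibre fibreD) mulnK.
pose E := ((A `|` B) `\` D)%fset.
have imE : #|` f @` E|%fset = #|` E|.
  apply: card_in_imfset => t s; rewrite !inE => _ sE /fibre[//|[-> sB]].
  by move: sE; rewrite sB andbT orbT andbT negbK CE => /eqP.
have DE : {in D & E, forall s t, f s != f t}.
  move=> s t sD tE; apply/eqP => /esym/fibre[ts|[ts sB]].
    by move: tE; rewrite ts in_fsetD sD.
  by move: tE; rewrite ts in_fsetD frobD_mem.
have DUE : (D `|` E = A `|` B)%fset.
  by apply/fsetP => s; rewrite !inE; do 3 case: (s \in _).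
have cardE : (#|` E| + (q ^ 2 - q))%N = #|` (A `|` B)%fset|.
  rewrite /E -cardD addnC -(cardfsID D (A `|` B)%fset); congr (_ + _)%N.
  by congr (#|` _|); apply/fsetP => s; rewrite !inE; do 3 case: (s \in _).
have AB : (A `&` B = if odd r then C else B)%fset.
  apply/fsetP => s; rewrite in_fsetI AE.
  have [sB|sB] := boolP (s \in B); last first.
    by rewrite andbF; case: odd; apply/esym/negbTE => //; apply: contra sB; apply/fsubsetP.
  move: (sB); rewrite BE => /eqP/(expr_frob_parity r) ->.
  by case: odd; rewrite ?andbT ?CE // eqxx sB.
have evenD : ((q ^ 2 - q) %/ 2 * 2 = q ^ 2 - q)%N.
  by rewrite -cardD (card_imfset_fibre fibreD) mulnK.
have count : (card_rational (q ^ r) (BallicoHefez K q) =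
    1 + ((q ^ 2 - q) %/ 2 + #|` E|))%N.
  rewrite /card_rational (BallicoHefez_rationalE AE BE) set_fsetK cardfsU1.
  have -> : Phi (infinity_pt K) \notin (f @` (A `|` B))%fset.
    by apply/imfsetP => -[s _ /esym]; apply: Phi_affine_neq_infinity.
  by rewrite -DUE imfset_cardU_disjoint // imD imE.
have := leq_pmull q (ltnW q1); rewrite mulnn => qq.
rewrite -signr_odd -natrX.
have := cardfsUI A B; rewrite -cardE AB cardA.
case: odd; rewrite ?cardB ?cardC => cardUI.
  rewrite mulN1r opprK natr1 -natrD; congr _%:R; lia.
rewrite mul1r; apply/eqP; rewrite eq_sym subr_eq natr1 -natrD; apply/eqP; congr _%:R; lia.
Qed.

End Frobenius.

Theorem corollary2p4 (p e q : nat) (p_prime : prime p) (e_gt0 : (0 < e)%N)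
    (q_def : q = (p ^ e)%N)
    (F : finFieldType) (cardF : #|F| = q)
    (K : closedFieldType) (iota : {rmorphism F -> K})
    (K_alg : integralRange iota) :
  zeta q (BallicoHefez K q) =
    (1 + 'T) ^+ ((q ^ 2 - q) %/ 2) / ((1 - 'T) * (1 - q%:R * 'T)).
Proof.
have charK : p \in [pchar K].
  by rewrite (fmorph_pchar iota) (@card_finPcharP _ _ e) // cardF.
apply: fps_exp_count => r r_gt0.
exact: (card_rational_BallicoHefez charK e_gt0 q_def).
Qed.
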